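(* Assume $A$ has no eigenvalue equal to $1$, let $M=C(I-A)^{-1}$ and $\gamma>0$. Suppose $\lambda\in\mathbb{R}_+$, $P\in\mathbb{S}^{n_x}_{\succ0}$, $\tilde Z\in\mathbb{S}^{n_y}_{\succ0}$, $G\in\mathbb{R}^{n_x\times n_y}$, $Y\in\mathbb{R}^{n_y\times n_a}$ satisfy $$\begin{bmatrix}P & PA-GC & PB_\omega-GD_\omega\\ * & P & 0\\ * & * & I\end{bmatrix}\succ0,\qquad \begin{bmatrix}\tilde Z & \tilde ZC & \tilde ZD_\omega\\ * & P & 0\\ * & 0 & I\end{bmatrix}\succ0,\qquad \begin{bmatrix}\Theta_1 & \begin{bmatrix}\Theta_2 & \Theta_3\end{bmatrix}\\ * & \begin{bmatrix}\tfrac1\gamma P & 0\\ 0 & \gamma P\end{bmatrix}\end{bmatrix}\succeq0,$$ where $$\Theta_1=\begin{bmatrix}D_a^\top Y+Y^\top D_a-\lambda D_a^\top WD_a & Y^\top\\ * & \tfrac12\tilde Z\end{bmatrix},\quad \Theta_2=\begin{bmatrix}-Y^\top M\\ 0\end{bmatrix},\quad \Theta_3=\begin{bmatrix}0\\ G^\top\end{bmatrix}.$$ Then with $L=P^{-1}G$ we have $\rho(A-LC)<1$ and $$\tfrac12D_a^\top(I+ML)^{-\top}\Sigma_{r_\omega}^{-1}(L)(I+ML)^{-1}D_a-\lambda D_a^\top WD_a\succeq0,$$ i.e., $(L,\lambda)$ is feasible for the steady-state design problem $\max_{L,\lambda\in\mathbb{R}_+}\{\lambda:\ \tfrac12D_a^\top\Phi(\infty,L)^\top\Sigma_{r_\omega}^{-1}(L)\Phi(\infty,L)D_a-\lambda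 D_a^\top WD_a\succeq0,\ \rho(A-LC)<1\}$ with $\Phi(\infty,L)=(I+ML)^{-1}$; maximizing $\lambda$ subject to these LMIs thus approximates that problem.
   Context: System: $x(k+1)=Ax(k)+Bu(k)+B_\omega\omega(k)$, $y(k)=Cx(k)+D_\omega\omega(k)+y_a(k)$, $x\in\mathbb{R}^{n_x}$, $y\in\mathbb{R}^{n_y}$, $\omega(k)\sim\mathcal N(0,I_{n_\omega})$ i.i.d., $(A,C)$ detectable, $(A,B_\omega)$ stabilizable; observer $\hat x(k+1)=A\hat x+Bu+L(y-C\hat x)$ with residual $r=y-C\hat x$. Bias injection attack $y_a(k)=D_a\bar a$ for $k\ge0$ (zero before), with $D_a\in\mathbb{R}^{n_y\times n_a}$ having entries $(j_i,i)=1$ for compromised sensor indices $j_1<\dots<j_{n_a}$ and zeros elsewhere; $W\in\mathbb{R}^{n_y\times n_y}$ symmetric positive semidefinite. $\rho$ is spectral radius, $\mathbb{R}_+$ the positive reals, $\mathbb{S}^n_{\succ0}$ the symmetric positive definite $n\times n$ matrices, $*$ denotes blocks determined by symmetry, and $X^{-\top}=(X^{-1})^\top$. For stabilizing $L$, $\Sigma_{\tilde x}(L)$ solves $\Sigma=(A-LC)\Sigma(A-LC)^\top+(B_\omega-LD_\omega)(B_\omega-LD_\omega)^\top$ and $\Sigma_{r_\omega}(L)=C\Sigma_{\tilde x}(L)C^\top+D_\omega D_\omega^\top$ (assumed invertible). The steady-state transition matrix is $\Phi(\infty,L)=I-C(I-A+LC)^{-1}L$, which equals $(I+ML)^{-1}$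 for stabilizing $L$ when $A$ has no unit eigenvalue. *)

(* Defs.v *)
From HB Require Import structures.
From mathcomp Require Import all_boot all_order all_algebra.
From mathcomp Require Import complex.
Set Implicit Arguments. Unset Strict Implicit. Unset Printing Implicit Defensive.
Import Order.TTheory GRing.Theory Num.Theory.
Local Open Scope ring_scope.

Definition posdef (R : realFieldType) (n : nat) (X : 'M[R]_n) : Prop :=
  X^T = X /\ forall v : 'cV[R]_n, v != 0 -> 0 < (v^T *m X *m v) 0 0.

Definition psd (R : realFieldType) (n : nat) (X : 'M[R]_n) : Prop :=
  X^T = X /\ forall v : 'cV[R]_n, 0 <= (v^T *m X *m v) 0 0.

Definition spectral_radius_lt1 (R : rcfType) (n : nat) (X : 'M[R]_n) : Prop :=
  forall z : R[i], eigenvalue (map_mx (fun x : R => (x%:C)%C) X) z -> `|z| < 1.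

(* D_a selects the compromised sensors j_1 < ... < j_{n_a} *)
Definition attack_matrix (R : ringType) (ny na : nat) (Da : 'M[R]_(ny, na)) : Prop :=
  exists j : 'I_na -> 'I_ny,
    (forall i1 i2 : 'I_na, (i1 < i2)%N -> (j i1 < j i2)%N) /\
    Da = \matrix_(r < ny, c < na) (if r == j c then 1 else 0).

Definition sigma_x_tilde (R : ringType) (nx ny nw : nat)
  (A : 'M[R]_nx) (Bw : 'M[R]_(nx, nw)) (C : 'M[R]_(ny, nx)) (Dw : 'M[R]_(ny, nw))
  (L : 'M[R]_(nx, ny)) (Sig : 'M[R]_nx) : Prop :=
  Sig = (A - L *m C) *m Sig *m (A - L *m C)^T
        + (Bw - L *m Dw) *m (Bw - L *m Dw)^T.

Definition sigma_r (R : ringType) (nx ny nw : nat)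
  (C : 'M[R]_(ny, nx)) (Dw : 'M[R]_(ny, nw)) (Sig : 'M[R]_nx) : 'M[R]_ny :=
  C *m Sig *m C^T + Dw *m Dw^T.

(* Main.v *)
(* Let Q = P^-1 and F = A - L C. The first LMI says Q > F Q F^T + H H^T with
    H = Bw - L Dw, so Q is a strict Lyapunov certificate for F^T: this yields
    the spectral radius bound. It also makes Q a strict supersolution of the
    Stein equation defining Sig, whence 0 <= Sig <= Q. As R is only a real
    closed field, this comparison cannot go through convergent series; it is
    derived from the least eigenvalue of a symmetric pencil. The second LMI then
    gives Zt <= Sigma_r^-1, and evaluating the third LMI at one explicit vector
    gives lambda Da^T W Da <= 1/2 E^T Zt E with E = (I + M L)^-1 Da. *)

Require Import Defs.
From HB Require Import structures.
From mathcomp Require Import all_boot all_order all_algebra.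
From mathcomp Require Import complex.
From mathcomp Require Import ring lra.
Import Order.TTheory GRing.Theory Num.Theory.
Local Open Scope ring_scope.

Set Implicit Arguments.
Unset Strict Implicit.
Unset Printing Implicit Defensive.

(** * The scalar product of column vectors *)

Definition dotc (R : comPzRingType) (n : nat) (x y : 'cV[R]_n) : R := (x^T *m y) 0 0.

Section Dot.
Variable R : comPzRingType.
Implicit Types m n : nat.

Lemma dotcC n (x y : 'cV[R]_n) : dotc x y = dotc y x.
Proof. by rewrite /dotc !mxE; apply: eq_bigr => i _; rewrite !mxE mulrC. Qed.

Lemma dotcDr n (x y z : 'cV[R]_n) : dotc x (y + z) = dotc x y + dotc x z.
Proof. by rewrite /dotc mulmxDr mxE. Qed.

Lemma dotcNr n (x y : 'cV[R]_n) : dotc x (- y) = - dotc x y.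
Proof. by rewrite /dotc mulmxN mxE. Qed.

Lemma dotcZr n a (x y : 'cV[R]_n) : dotc x (a *: y) = a * dotc x y.
Proof. by rewrite /dotc -scalemxAr mxE. Qed.

Lemma dotc0r n (x : 'cV[R]_n) : dotc x 0 = 0.
Proof. by rewrite /dotc mulmx0 mxE. Qed.

Lemma dotcDl n (x y z : 'cV[R]_n) : dotc (x + y) z = dotc x z + dotc y z.
Proof. by rewrite !(dotcC _ z) dotcDr. Qed.

Lemma dotcNl n (x y : 'cV[R]_n) : dotc (- x) y = - dotc x y.
Proof. by rewrite !(dotcC _ y) dotcNr. Qed.

Lemma dotcZl n a (x y : 'cV[R]_n) : dotc (a *: x) y = a * dotc x y.
Proof. by rewrite !(dotcC _ y) dotcZr. Qed.

Lemma dotc0l n (x : 'cV[R]_n) : dotc 0 x = 0.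
Proof. by rewrite dotcC dotc0r. Qed.

Definition dotcE := (dotcDr, dotcDl, dotcNr, dotcNl, dotcZr, dotcZl, dotc0r, dotc0l).

Lemma dotc_mulmxl m n (X : 'M[R]_(m, n)) x y : dotc (X *m x) y = dotc x (X^T *m y).
Proof. by rewrite /dotc trmx_mul mulmxA. Qed.

Lemma dotc_col_mx m n (a c : 'cV[R]_m) (b d : 'cV[R]_n) :
  dotc (col_mx a b) (col_mx c d) = dotc a c + dotc b d.
Proof. by rewrite /dotc tr_col_mx mul_row_col mxE. Qed.

Lemma quad_dotc n (X : 'M[R]_n) v : (v^T *m X *m v) 0 0 = dotc v (X *m v).
Proof. by rewrite /dotc mulmxA. Qed.

Lemma dotc_sym n (X : 'M[R]_n) x y : X^T = X -> dotc x (X *m y) = dotc y (X *m x).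
Proof. by move=> sX; rewrite dotcC dotc_mulmxl sX. Qed.

Lemma dotc_block m n (X : 'M[R]_m) (Y : 'M[R]_(m, n)) (Z : 'M[R]_n) a b :
  dotc (col_mx a b) (block_mx X Y Y^T Z *m col_mx a b) =
  dotc a (X *m a) + dotc a (Y *m b) *+ 2 + dotc b (Z *m b).
Proof.
rewrite mul_block_col dotc_col_mx !dotcDr -(dotc_mulmxl Y) (dotcC (Y *m b)) mulr2n.
by rewrite !addrA.
Qed.

Lemma dotc_inj m n (X : 'M[R]_(m, n)) : (forall a b, dotc a (X *m b) = 0) -> X = 0.
Proof.
move=> X0; apply/matrixP => i j; rewrite mxE -(X0 (delta_mx i 0) (delta_mx j 0)).
by rewrite /dotc trmx_delta -colE -rowE !mxE.
Qed.

End Dot.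

(** [kermx] is a left kernel, hence the passage to [X^T]: each row of [kermx X^T] transposes to a
    vector killed by [X]. *)
Lemma unitmx_ker0 (R : fieldType) n (X : 'M[R]_n) : (forall v : 'cV_n, X *m v = 0 -> v = 0) -> X \in unitmx.
Proof.
move=> kX; rewrite -unitmx_tr -row_free_unit; apply/row_freeP.
suff: kermx X^T == 0 by rewrite kermx_eq0 => /row_freeP.
apply/eqP/row_matrixP => i; rewrite row0.
apply: trmx_inj; rewrite trmx0; apply: kX; apply: trmx_inj.
by rewrite trmx_mul trmxK trmx0; apply/sub_kermxP; rewrite row_sub.
Qed.

(** * Definite matrices, their inverses and Schur complements *)

Section Definite.
Variable R : realFieldType.

Lemma posdef_gt0 n (X : 'M[R]_n) v : posdef X -> v != 0 -> 0 < dotc v (X *m v).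
Proof. by case=> _ pX /pX; rewrite quad_dotc. Qed.

Lemma posdef_ge0 n (X : 'M[R]_n) v : posdef X -> 0 <= dotc v (X *m v).
Proof.
move=> pX; have [->|/(posdef_gt0 pX)/ltW//] := eqVneq v 0.
by rewrite dotc0l.
Qed.

Lemma psd_ge0 n (X : 'M[R]_n) v : psd X -> 0 <= dotc v (X *m v).
Proof. by case=> _ pX; rewrite -quad_dotc. Qed.

Lemma dotcc_ge0 n (v : 'cV[R]_n) : 0 <= dotc v v.
Proof. by rewrite /dotc mxE sumr_ge0 // => i _; rewrite !mxE -expr2 sqr_ge0. Qed.

Lemma posdef_unitmx n (X : 'M[R]_n) : posdef X -> X \in unitmx.
Proof.
move=> pX; apply: unitmx_ker0 => v Xv; apply/eqP/negPn/negP => /(posdef_gt0 pX).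
by rewrite Xv dotc0r ltxx.
Qed.

Lemma posdef_invmx n (X : 'M[R]_n) : posdef X -> posdef (invmx X).
Proof.
move=> pX; have uX := posdef_unitmx pX; have sV : (invmx X)^T = invmx X.
  by rewrite trmx_inv; case: pX => ->.
split=> // v v0; rewrite quad_dotc -{1}[v](mulKVmx uX) dotcC -dotc_sym; last by case: pX.
by apply: posdef_gt0 => //; apply: contra v0 => /eqP Vv; rewrite -[v](mulKVmx uX) Vv mulmx0.
Qed.

Lemma posdef_schur m n (X : 'M[R]_m) (Y : 'M_(m, n)) (Z : 'M_n) :
  posdef (block_mx X Y Y^T Z) -> posdef X /\ posdef (Z - Y^T *m invmx X *m Y).
Proof.
move=> pB; have [sX _ _ sZ] : [/\ X^T = X, Y^T^T = Y, Y^T = Y^T & Z^T = Z].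
  by case: pB => sB _; apply/eq_block_mx; rewrite -tr_block_mx.
have pX : posdef X.
  split=> // v v0; have := posdef_gt0 pB (v := col_mx v 0).
  rewrite dotc_block quad_dotc !(mulmx0, dotcE) mul0rn !addr0; apply.
  by rewrite col_mx_eq0 negb_and v0.
split=> //; split; first by rewrite linearB /= !trmx_mul trmxK trmx_inv sX sZ mulmxA.
(* For fixed [v], this first block minimizes the block form; the minimum is the form of the Schur
   complement at [v]. *)
move=> v v0; have := posdef_gt0 pB (v := col_mx (- (invmx X *m (Y *m v))) v).
rewrite col_mx_eq0 negb_and v0 orbT dotc_block quad_dotc => /(_ isT).
rewrite !(mulmxN, mulmxDl, mulNmx, dotcE) mulKVmx ?posdef_unitmx //.
rewrite -!mulmxA -(dotc_mulmxl Y) (dotcC (Y *m v)); lra.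
Qed.

End Definite.

(** * Cholesky factorization and least eigenvalues of symmetric pencils *)

(** Induction peels off the first row and column: the Schur complement is factored as [K^T *m K],
    and the pivot contributes the row [(s, b / s)], with [s] its square root, available since [R] is
    real closed. *)
Lemma cholesky (R : rcfType) n (Q : 'M[R]_n) :
  posdef Q -> exists2 K, K \in unitmx & Q = K^T *m K.
Proof.
elim: n Q => [|n IHn] Q.
  by move=> _; exists 1%:M; [rewrite unitmx1 | apply/matrixP => - []].
rewrite -[n.+1]/(1 + n)%N in Q *; rewrite -[Q]submxK.
set a := ulsubmx _; set b := ursubmx _; set c := dlsubmx _; set d := drsubmx _ => pQ.
have cE : c = b^T.
  by case: (pQ) => sQ _; move: sQ; rewrite tr_block_mx => /eq_block_mx[].
rewrite cE in pQ *; have [pa /IHn [K uK dE]] := posdef_schur pQ.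
have a_gt0 : 0 < a 0 0.
  have := posdef_gt0 pa (v := 1%:M); rewrite /dotc trmx1 mulmx1 mul1mx; apply.
  exact: oner_neq0.
set s := Num.sqrt (a 0 0); have s_gt0 : 0 < s by rewrite sqrtr_gt0.
have aE : a = (s * s)%:M by rewrite -expr2 sqr_sqrtr ?ltW // -mx11_scalar.
exists (block_mx s%:M (s^-1 *: b) 0 K).
  by rewrite unitmxE det_ublock det_scalar1 unitrM -unitmxE uK andbT unitfE gt_eqF.
rewrite tr_block_mx mulmx_block trmx0 !mul0mx !mulmx0 !addr0 tr_scalar_mx -scalar_mxM -aE.
rewrite mul_scalar_mx scalerA divff ?gt_eqF // scale1r.
rewrite linearZ /= mul_mx_scalar scalerA divff ?gt_eqF // scale1r; congr block_mx.
rewrite -dE aE invmx_scalar mul_mx_scalar -scalemxAl -scalemxAl -scalemxAr scalerA invfM.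
by rewrite addrC subrK.
Qed.

Section MinimalEigenvalue.
Variable R : rcfType.
Local Open Scope sesquilinear_scope.

(** The spectral theorem is applied over [R[i]], where [S] becomes hermitian with real eigenvalues.
    The least of them is an eigenvalue over [R] as well, and the inequality descends because the
    embedding of [R] reflects the order. *)
Lemma symmetric_min_eigen n (S : 'M[R]_n.+1) : S^T = S ->
  exists2 m, eigenvalue S m & forall u : 'rV_n.+1, m * (u *m u^T) 0 0 <= (u *m S *m u^T) 0 0.
Proof.
move=> sS; pose f := real_complex R; pose SC := map_mx f S.
have SCr : SC \is a mxOver Num.real.
  by apply/mxOverP => i j; rewrite mxE; apply/complex_realP; exists (S i j).
have SCh : SC \is hermsymmx.
  apply: realsym_hermsym => //; apply/is_hermitianmxP.
  by rewrite expr0 scale1r map_mx_id // /SC map_trmx sS.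
have := orthomx_spectralP (hermitian_normalmx SCh).
have /mxOverP := hermitian_spectral_diag_real SCh.
set U := spectralmx SC; set sp := spectral_diag SC => sp_real SCE.
have uU : U \is unitarymx by apply: spectral_unitarymx.
pose e i := complex.Re (sp 0 i); have spE i : sp 0 i = f (e i).
  by rewrite /e; have /complex_realP[k ->] := sp_real 0 i.
have [i0 _ i0_min] := @Order.TotalTheory.arg_minP _ _ _ (ord0 : 'I_n.+1) xpredT e isT.
exists (e i0).
  rewrite -(eigenvalue_map f); apply/eigenvalueP; exists (row i0 U).
    rewrite -/SC SCE !mulmxA -row_mul mulmxV ?unitarymx_unit // row1 -rowE row_diag_mx.
    by rewrite -scalemxAl -rowE spE.
  apply/negP => /eqP U0; have /row_unitarymxP/(_ i0 i0) := uU.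
  by rewrite U0 linear0l eqxx => /eqP; rewrite eq_sym oner_eq0.
(* [w] holds the coordinates of [u] in the eigenbasis; both forms become sums weighted by the
   squared moduli of these coordinates, compared termwise. *)
move=> u; pose w := map_mx f u *m U^t*.
have conjf k l (X : 'M[R]_(k, l)) : map_mx Num.conj (map_mx f X) = map_mx f X.
  by apply/matrixP => i j; rewrite !mxE; apply: conjc_real.
have wE : w^t* = U *m (map_mx f u)^T.
  rewrite /w trmx_mul map_mxM trmxCK. by rewrite -map_trmx conjf.
have uuE : f ((u *m u^T) 0 0) = (w *m w^t*) 0 0.
  by rewrite wE mulmxA mulmxKtV //; rewrite map_trmx -map_mxM [RHS]mxE.
have uSuE : f ((u *m S *m u^T) 0 0) = (w *m diag_mx sp *m w^t*) 0 0.
  rewrite wE /w -!mulmxA -invmx_unitary // (mulmxA (diag_mx _)) (mulmxA (invmx U)).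
  by rewrite [invmx U *m _]mulmxA -SCE map_trmx -!map_mxM [RHS]mxE.
suff: f (e i0 * (u *m u^T) 0 0) <= f ((u *m S *m u^T) 0 0) by rewrite lecR.
have fM x y : f (x * y) = f x * f y by apply: (rmorphM (real_complex R)).
rewrite fM uuE uSuE mul_mx_diag [(w *m _) 0 0]mxE [X in _ <= X]mxE mulr_sumr; apply: ler_sum => i _.
rewrite [(w^t*) _ _]mxE [w^T _ _]mxE mxE (mulrC _ (sp 0 i)) -mulrA spE.
by rewrite ler_wpM2r ?mul_conjC_ge0 ?lecR ?i0_min.
Qed.
End MinimalEigenvalue.

(** With [Q = K^T K], the substitution [w = K u] turns [Q] into the identity and [D] into [S], which
    leaves an ordinary symmetric eigenvalue problem. *)
Lemma pencil_min_eigen (R : rcfType) n (Q D : 'M[R]_n.+1) : posdef Q -> D^T = D ->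
  exists m v, [/\ v != 0, dotc v (D *m v) = m * dotc v (Q *m v) &
    forall u, m * dotc u (Q *m u) <= dotc u (D *m u)].
Proof.
move=> /cholesky[K uK ->] sD; pose J := invmx K; pose S := J^T *m D *m J.
have [|m /eigenvalueP[w wS w0] m_min] := symmetric_min_eigen (S := S).
  by rewrite /S !trmx_mul trmxK sD mulmxA.
have KK u : dotc u (K^T *m K *m u) = ((K *m u)^T *m (K *m u)^T^T) 0 0.
  by rewrite /dotc trmxK trmx_mul !mulmxA.
have DS u : dotc u (D *m u) = ((K *m u)^T *m S *m (K *m u)^T^T) 0 0.
  rewrite /dotc /S /J trmxK trmx_mul !mulmxA trmx_inv mulmxK ?unitmx_tr //.
  by rewrite -!mulmxA mulKmx ?mulmxA.
exists m, (J *m w^T); split=> [||u]; last by rewrite KK DS.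
  by apply: contra w0 => /eqP Jw; rewrite -trmx_eq0 -(mulKVmx uK w^T) Jw mulmx0.
by rewrite DS KK !mulKVmx // !trmxK wS -scalemxAl mxE.
Qed.

(** * Stein equations: comparison, uniqueness and spectral radius *)

(* At a minimizer [v] of the Rayleigh quotient of the pencil [(D, Q)], with
   minimum [m < 0], one step of [F^T] would multiply [v^T Q v] by at least 1. *)
Lemma stein_psd (R : rcfType) n (Q F D : 'M[R]_n) :
  posdef Q ->
  (forall v, v != 0 -> dotc (F^T *m v) (Q *m (F^T *m v)) < dotc v (Q *m v)) ->
  D^T = D ->
  (forall v, dotc (F^T *m v) (D *m (F^T *m v)) <= dotc v (D *m v)) ->
  psd D.
Proof.
case: n Q F D => [|n] Q F D pQ FQ sD FD; split=> // u; rewrite quad_dotc.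
  by rewrite (flatmx0 u) dotc0l.
have [m [v [v0 Dv m_min]]] := pencil_min_eigen pQ sD.
have [m0|m0] := leP 0 m.
  by apply: le_trans (m_min u); rewrite mulr_ge0 ?posdef_ge0.
have := le_trans (m_min _) (FD v); rewrite Dv ler_nM2l //.
by rewrite leNgt FQ.
Qed.

(* Applied to the symmetric matrix [[0, E], [E^T, 0]], the comparison above
   also handles a non-symmetric [E]. *)
Lemma stein_uniq (R : rcfType) n (Q F E : 'M[R]_n) :
  posdef Q ->
  (forall v, v != 0 -> dotc (F^T *m v) (Q *m (F^T *m v)) < dotc v (Q *m v)) ->
  E = F *m E *m F^T -> E = 0.
Proof.
move=> pQ FQ EE.
have QFle v : dotc (F^T *m v) (Q *m (F^T *m v)) <= dotc v (Q *m v).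
  by have [->|/FQ/ltW//] := eqVneq v 0; rewrite mulmx0 dotc0l.
have dQ a b : dotc (col_mx a b) (block_mx Q 0 0 Q *m col_mx a b) =
    dotc a (Q *m a) + dotc b (Q *m b).
  by rewrite mul_block_col !mul0mx addr0 add0r dotc_col_mx.
have dE a b : dotc (col_mx a b) (block_mx 0 E E^T 0 *m col_mx a b) = dotc a (E *m b) *+ 2.
  by rewrite dotc_block !mul0mx !dotcE add0r addr0.
have FE a b : (block_mx F 0 0 F)^T *m col_mx a b = col_mx (F^T *m a) (F^T *m b).
  by rewrite tr_block_mx !trmx0 mul_block_col !mul0mx addr0 add0r.
have pE : psd (block_mx 0 E E^T 0).
  apply: (stein_psd (Q := block_mx Q 0 0 Q) (F := block_mx F 0 0 F)).
  - split=> [|v]; first by rewrite tr_block_mx !trmx0; case: pQ => ->.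
    rewrite -[v]vsubmxK quad_dotc dQ col_mx_eq0 negb_and => /orP[] v0.
      by rewrite ltr_pwDl ?posdef_gt0 ?posdef_ge0.
    by rewrite ltr_wpDl ?posdef_gt0 ?posdef_ge0.
  - move=> v; rewrite -[v]vsubmxK FE !dQ col_mx_eq0 negb_and => /orP[] v0.
      by rewrite ltr_leD ?FQ.
    by rewrite ler_ltD ?FQ.
  - by rewrite tr_block_mx !trmx0 trmxK.
  move=> v; rewrite -[v]vsubmxK FE !dE dotc_mulmxl trmxK.
  by rewrite [F *m _]mulmxA [F *m E *m _]mulmxA -EE lexx.
(* The block form at [(a, b)] is [2 a^T E b], odd in [a]; nonnegativity at both [a] and [- a] forces
   it to vanish. *)
apply: dotc_inj => a b; apply/eqP; rewrite eq_le.
have := psd_ge0 (col_mx a b) pE; have := psd_ge0 (col_mx (- a) b) pE.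
by rewrite !dE dotcE !mulr2n => h1 h2; apply/andP; split; lra.
Qed.

(** The difference [X - X^T] solves the homogeneous equation, so [stein_uniq] kills it. Since
    [sigma_x_tilde] prescribes only an equation, the symmetry of [Sig] comes from here. *)
Lemma stein_solution_sym (R : rcfType) n (Q F N X : 'M[R]_n) :
  posdef Q ->
  (forall v, v != 0 -> dotc (F^T *m v) (Q *m (F^T *m v)) < dotc v (Q *m v)) ->
  N^T = N -> X = F *m X *m F^T + N -> X^T = X.
Proof.
move=> pQ FQ sN XE; apply/eqP; rewrite -subr_eq0; apply/eqP; apply: (stein_uniq pQ FQ).
rewrite mulmxBr mulmxBl {1 2}XE linearD /= !trmx_mul trmxK sN mulmxA.
by rewrite opprD addrACA subrr addr0.
Qed.

(** A left eigenvector is split into real and imaginary parts [a] and [b]. On them [F^T] acts as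
    [|z|] times a rotation, so the sum of their [Q]-forms is multiplied by [|z|^2], while the
    hypothesis makes it strictly smaller. *)
Lemma contraction_spectral_radius (R : rcfType) n (Q F : 'M[R]_n) :
  posdef Q ->
  (forall v, v != 0 -> dotc (F^T *m v) (Q *m (F^T *m v)) < dotc v (Q *m v)) ->
  spectral_radius_lt1 F.
Proof.
move=> pQ FQ z /eigenvalueP[v vF v0].
pose a := (map_mx (@complex.Re R) v)^T; pose b := (map_mx (@complex.Im R) v)^T.
case: z vF => s t vF.
have FRe : F^T *m a = s *: a - t *: b.
  apply: trmx_inj; apply/rowP => j; move/rowP/(_ j)/(congr1 (@complex.Re R)): vF.
  rewrite !mxE raddf_sum /= => vFj; transitivity (complex.Re ((s +i* t)%C * v 0 j)).
    rewrite -vFj; apply: eq_bigr => i _; rewrite !mxE.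
    by case: (v 0 i) => x y /=; rewrite mulr0 subr0 mulrC.
  by case: (v 0 j).
have FIm : F^T *m b = t *: a + s *: b.
  apply: trmx_inj; apply/rowP => j; move/rowP/(_ j)/(congr1 (@complex.Im R)): vF.
  rewrite !mxE raddf_sum /= => vFj; transitivity (complex.Im ((s +i* t)%C * v 0 j)).
    rewrite -vFj; apply: eq_bigr => i _; rewrite !mxE.
    by case: (v 0 i) => x y /=; rewrite mulr0 add0r mulrC.
  by case: (v 0 j) => x y /=; rewrite addrC.
have ab0 : (a != 0) || (b != 0).
  rewrite -negb_and; apply: contra v0 => /andP[/eqP a0 /eqP b0].
  apply/eqP/rowP => j; apply/eqP; rewrite eq_complex !mxE.
  move/colP/(_ j): a0; move/colP/(_ j): b0; rewrite !mxE => -> ->.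
  by rewrite eqxx.
have qab : dotc (F^T *m a) (Q *m (F^T *m a)) + dotc (F^T *m b) (Q *m (F^T *m b)) =
    (s ^+ 2 + t ^+ 2) * (dotc a (Q *m a) + dotc b (Q *m b)).
  rewrite FRe FIm !(mulmxDr, mulmxBr, mulmxN, dotcE) -!scalemxAr !dotcE.
  by rewrite (dotc_sym b a) ?(proj1 pQ) //; ring.
have qlt : (s ^+ 2 + t ^+ 2) * (dotc a (Q *m a) + dotc b (Q *m b)) <
    dotc a (Q *m a) + dotc b (Q *m b).
  have QFle u : dotc (F^T *m u) (Q *m (F^T *m u)) <= dotc u (Q *m u).
    by have [->|/FQ/ltW//] := eqVneq u 0; rewrite mulmx0 dotc0l.
  by rewrite -qab; case/orP: ab0 => u0; [apply: ltr_leD | apply: ler_ltD]; rewrite ?FQ.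
have qgt : 0 < dotc a (Q *m a) + dotc b (Q *m b).
  case/orP: ab0 => u0.
    by rewrite ltr_pwDl ?posdef_gt0 ?posdef_ge0.
  by rewrite ltr_wpDl ?posdef_gt0 ?posdef_ge0.
have st1 : s ^+ 2 + t ^+ 2 < 1 by rewrite -(ltr_pM2r qgt) mul1r.
by rewrite normc_def /= ltcR -sqrtr1 ltr_sqrt.
Qed.

(** A nonzero vector fixed by [F^T] would contradict the strict decrease. *)
Lemma contraction_unitmx (R : rcfType) n (Q F : 'M[R]_n) :
  (forall v, v != 0 -> dotc (F^T *m v) (Q *m (F^T *m v)) < dotc v (Q *m v)) ->
  1%:M - F \in unitmx.
Proof.
move=> FQ; rewrite -unitmx_tr; apply: unitmx_ker0 => v.
rewrite linearB /= trmx1 mulmxBl mul1mx => /eqP; rewrite subr_eq0 => /eqP vE.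
by apply/eqP/negPn/negP => /FQ; rewrite -vE ltxx.
Qed.

(** * Quadratic inequalities extracted from the LMIs *)

(* The first LMI at [(Q v, - Q F^T v, - H^T v)], where [Q = P^-1]. *)
Lemma lyapunov_lmi_contraction (R : realFieldType) n p (P F : 'M[R]_n) (H : 'M_(n, p)) :
  posdef P ->
  posdef (block_mx P (row_mx (P *m F) (P *m H))
    (col_mx (P *m F)^T (P *m H)^T) (block_mx P 0 0 1%:M)) ->
  forall v, v != 0 ->
    dotc (F^T *m v) (invmx P *m (F^T *m v)) + dotc (H^T *m v) (H^T *m v)
      < dotc v (invmx P *m v).
Proof.
rewrite -tr_row_mx => pP pB v v0; have uP := posdef_unitmx pP; have [sP _] := pP.
pose a := invmx P *m v; pose b := - (invmx P *m (F^T *m v)); pose c := - (H^T *m v).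
have PaE : P *m a = v by rewrite mulKVmx.
have := posdef_gt0 pB (v := col_mx a (col_mx b c)).
rewrite col_mx_eq0 negb_and {1}/a.
have -> : invmx P *m v != 0 by apply: contra v0 => /eqP Pv; rewrite -PaE /a Pv mulmx0.
rewrite dotc_block mul_row_col mul_block_col !mul0mx addr0 add0r mul1mx dotc_col_mx.
rewrite PaE -!mulmxA -mulmxDr (dotc_sym a) // PaE (dotcC a v).
rewrite dotcDl !(dotc_mulmxl _ _ v) /b /c !(mulmxN, dotcE) mulKVmx //.
rewrite (dotcC _ (F^T *m v)) => /(_ isT); lra.
Qed.

(* The second LMI at [(a, - Q C^T Z a, - D^T Z a)], where [Q = P^-1]. *)
Lemma residual_lmi_bound (R : realFieldType) ny nx nw (Z : 'M[R]_ny) (P : 'M_nx)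
    (C : 'M_(ny, nx)) (D : 'M_(ny, nw)) :
  posdef P -> posdef Z ->
  posdef (block_mx Z (row_mx (Z *m C) (Z *m D))
    (col_mx (Z *m C)^T (Z *m D)^T) (block_mx P 0 0 1%:M)) ->
  forall a, dotc (C^T *m (Z *m a)) (invmx P *m (C^T *m (Z *m a)))
      + dotc (D^T *m (Z *m a)) (D^T *m (Z *m a)) <= dotc a (Z *m a).
Proof.
rewrite -tr_row_mx => pP pZ pB a; have uP := posdef_unitmx pP; have [sZ _] := pZ.
pose b := - (invmx P *m (C^T *m (Z *m a))); pose c := - (D^T *m (Z *m a)).
have := posdef_ge0 (col_mx a (col_mx b c)) pB.
rewrite dotc_block mul_row_col mul_block_col !mul0mx addr0 add0r mul1mx dotc_col_mx.
rewrite -!mulmxA -mulmxDr (dotc_sym a) //.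
rewrite dotcDl !(dotc_mulmxl _ _ (Z *m a)) /b /c !(mulmxN, dotcE) mulKVmx //.
rewrite (dotcC _ (C^T *m (Z *m a))); lra.
Qed.

(** Expand the form of [S] at [S^-1 x - y]. Through a test vector [y], an upper estimate of [S] thus
    yields a lower estimate of its inverse. *)
Lemma dotc_invmx_ge (R : realFieldType) n (S : 'M[R]_n) x y :
  psd S -> S \in unitmx -> dotc x y *+ 2 - dotc y (S *m y) <= dotc x (invmx S *m x).
Proof.
move=> pS uS; have [sS _] := pS; have := psd_ge0 (invmx S *m x - y) pS.
rewrite mulmxBr mulKVmx // !dotcE (dotc_sym _ y) // mulKVmx //.
rewrite (dotcC _ x) (dotcC y) mulr2n; lra.
Qed.

(* The inverse of [I + M L] is the transition matrix [I - C (I - A + L C)^-1 L]. *)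
Lemma transition_unitmx (R : fieldType) nx ny (A : 'M[R]_nx) (C : 'M_(ny, nx)) (L : 'M_(nx, ny)) :
  1%:M - A \in unitmx -> 1%:M - (A - L *m C) \in unitmx ->
  1%:M + C *m invmx (1%:M - A) *m L \in unitmx.
Proof.
move=> uA uF; apply: unitmx_ker0 => u; rewrite mulmxDl mul1mx => /eqP.
(* A kernel vector [u] equals [- C x] with [x = (I - A)^-1 L u]; this [x] is killed by
   [I - A + L C], so it is zero. *)
rewrite addr_eq0 => /eqP uE; pose x := invmx (1%:M - A) *m (L *m u).
have {}uE : u = - (C *m x) by rewrite {1}uE /x !mulmxA.
have xE : (1%:M - A) *m x = - (L *m C *m x) by rewrite mulKVmx // {1}uE mulmxN mulmxA.
have x0 : (1%:M - (A - L *m C)) *m x = 0 by rewrite opprB addrCA mulmxDl xE addrN.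
by rewrite uE -[x](mulKmx uF) x0 !mulmx0 oppr0.
Qed.

(* The third LMI at [(u, - e, L e, L e / gamma)] with [(I + M L) e = Da u]: the
   terms in [Y] cancel, and so do those in [P]. *)
Lemma attack_lmi_bound (R : realFieldType) nx ny na (gamma lambda : R)
    (M : 'M[R]_(ny, nx)) (L : 'M_(nx, ny)) (P : 'M_nx) (Z W : 'M[R]_ny)
    (G : 'M[R]_(nx, ny)) (Y Da : 'M[R]_(ny, na)) :
  0 < gamma -> P^T = P -> G = P *m L ->
  psd (block_mx (block_mx (Da^T *m Y + Y^T *m Da - lambda *: (Da^T *m W *m Da)) Y^T
                          Y (2^-1 *: Z))
        (row_mx (col_mx (- (Y^T *m M)) 0) (col_mx 0 G^T))
        (row_mx (col_mx (- (Y^T *m M)) 0) (col_mx 0 G^T))^T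
        (block_mx (gamma^-1 *: P) 0 0 (gamma *: P))) ->
  forall u e, (1%:M + M *m L) *m e = Da *m u ->
    lambda * dotc (Da *m u) (W *m (Da *m u)) <= 2^-1 * dotc e (Z *m e).
Proof.
move=> g0 sP GE pT u e eE; pose p := L *m e; pose r := gamma^-1 *: p.
have MpE : M *m p = Da *m u - e by rewrite -eE mulmxDl mul1mx addrAC subrr add0r mulmxA.
have := psd_ge0 (col_mx (col_mx u (- e)) (col_mx p r)) pT.
rewrite dotc_block mul_row_col !mul_block_col !mul_col_mx !mul0mx add0r !addr0.
rewrite add_col_mx addr0 add0r !dotc_col_mx.
rewrite !(mulmxDl, mulNmx, mulmxN) -!scalemxAl -!mulmxA !dotcE MpE.
rewrite -!dotc_mulmxl GE -mulmxA -/p (dotc_mulmxl P) sP /r -!scalemxAr !dotcE.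
rewrite mulVKf ?gt_eqF // !(dotcC _ (Y *m u)) (dotcC p); lra.
Qed.

Lemma noneigenvalue_unitmx (F : fieldType) n (A : 'M[F]_n) a :
  ~ eigenvalue A a -> a%:M - A \in unitmx.
Proof.
move=> Aa; rewrite -unitmx_tr; apply: unitmx_ker0 => v.
rewrite linearB /= tr_scalar_mx mulmxBl mul_scalar_mx => /eqP; rewrite subr_eq0 => /eqP vE.
apply/eqP/negPn/negP => v0; apply: Aa; apply/eigenvalueP; exists v^T; last by rewrite trmx_eq0.
by rewrite -linearZ /= vE trmx_mul trmxK.
Qed.

Theorem theorem4 (R : rcfType) (nx ny nw na : nat)
  (A : 'M[R]_nx) (Bw : 'M[R]_(nx, nw)) (C : 'M[R]_(ny, nx))
  (Dw : 'M[R]_(ny, nw)) (Da : 'M[R]_(ny, na)) (W : 'M[R]_ny)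
  (gamma lambda : R) (P : 'M[R]_nx) (Zt : 'M[R]_ny)
  (G : 'M[R]_(nx, ny)) (Y : 'M[R]_(ny, na)) :
  attack_matrix Da ->
  psd W ->
  ~ eigenvalue A 1 ->
  0 < gamma ->
  0 < lambda ->
  posdef P ->
  posdef Zt ->
  let M := C *m invmx (1%:M - A) in
  posdef (block_mx P (row_mx (P *m A - G *m C) (P *m Bw - G *m Dw))
                   (col_mx (P *m A - G *m C)^T (P *m Bw - G *m Dw)^T)
                   (block_mx P 0 0 1%:M)) ->
  posdef (block_mx Zt (row_mx (Zt *m C) (Zt *m Dw))
                   (col_mx (Zt *m C)^T (Zt *m Dw)^T)
                   (block_mx P 0 0 1%:M)) ->
  let Theta1 := block_mx (Da^T *m Y + Y^T *m Da - lambda *: (Da^T *m W *m Da))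
                         Y^T Y (2^-1 *: Zt) in
  let Theta2 := col_mx (- (Y^T *m M)) (0 : 'M[R]_(ny, nx)) in
  let Theta3 := col_mx (0 : 'M[R]_(na, nx)) G^T in
  psd (block_mx Theta1 (row_mx Theta2 Theta3)
                (row_mx Theta2 Theta3)^T
                (block_mx (gamma^-1 *: P) 0 0 (gamma *: P))) ->
  let L := invmx P *m G in
  spectral_radius_lt1 (A - L *m C) /\
  (1%:M + M *m L) \in unitmx /\
  (forall Sig : 'M[R]_nx, sigma_x_tilde A Bw C Dw L Sig ->
     sigma_r C Dw Sig \in unitmx ->
     psd (2^-1 *: (Da^T *m (invmx (1%:M + M *m L))^T *m invmx (sigma_r C Dw Sig)
                   *m invmx (1%:M + M *m L) *m Da)
          - lambda *: (Da^T *m W *m Da))).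
Proof.
move=> _ [sW _] A1 g0 _ pP pZ M lmi1 lmi2 T1 T2 T3 lmi3 L.
have GE : G = P *m L by rewrite mulKVmx // posdef_unitmx.
clearbody L; set F := A - L *m C; pose H := Bw - L *m Dw; pose Q := invmx P.
have pQ : posdef Q by apply: posdef_invmx.
(* With [G = P L], the blocks of the first LMI are expressed through the error dynamics [F] and
   [H]. *)
have PFE : P *m A - G *m C = P *m F by rewrite mulmxBr mulmxA -GE.
have PHE : P *m Bw - G *m Dw = P *m H by rewrite mulmxBr mulmxA -GE.
rewrite PFE PHE in lmi1; have FHQ := lyapunov_lmi_contraction pP lmi1.
have FQ v : v != 0 -> dotc (F^T *m v) (Q *m (F^T *m v)) < dotc v (Q *m v).
  by move=> /FHQ; apply: le_lt_trans; rewrite lerDl dotcc_ge0.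
have uJ : 1%:M + M *m L \in unitmx.
  by apply: transition_unitmx; [exact: noneigenvalue_unitmx | exact: contraction_unitmx FQ].
split; first exact: contraction_spectral_radius pQ FQ.
clearbody M; split=> // Sig SigE; set S := sigma_r C Dw Sig => uS.
have sHH : (H *m H^T)^T = H *m H^T by rewrite trmx_mul trmxK.
have sSig := stein_solution_sym pQ FQ sHH SigE.
have dSig v : dotc v (Sig *m v) =
    dotc (F^T *m v) (Sig *m (F^T *m v)) + dotc (H^T *m v) (H^T *m v).
  by rewrite {1}SigE mulmxDl dotcDr -!mulmxA !dotc_mulmxl !trmxK.
have pSig : psd Sig.
  by apply: (stein_psd pQ FQ sSig) => v; rewrite [leRHS]dSig lerDl dotcc_ge0.
(* Subtracting the Stein equation of [Sig] from [FHQ] cancels the terms in [H], which leaves the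
   Stein inequality for [Q - Sig]. *)
have SigQ v : dotc v (Sig *m v) <= dotc v (Q *m v).
  have /(psd_ge0 v) : psd (Q - Sig).
    apply: (stein_psd pQ FQ); first by rewrite linearB /= sSig (proj1 pQ).
    move=> x; have [->|/FHQ] := eqVneq x 0; first by rewrite !mulmx0.
    by rewrite !mulmxBl !dotcE (dSig x); lra.
  by rewrite mulmxBl !dotcE subr_ge0.
have dS v : dotc v (S *m v) =
    dotc (C^T *m v) (Sig *m (C^T *m v)) + dotc (Dw^T *m v) (Dw^T *m v).
  by rewrite mulmxDl dotcDr -!mulmxA !dotc_mulmxl !trmxK.
have pS : psd S.
  split; first by rewrite linearD /= !trmx_mul !trmxK sSig mulmxA.
  by move=> v; rewrite quad_dotc dS addr_ge0 ?dotcc_ge0 ?psd_ge0.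
split=> [|u].
  have sV : (invmx S)^T = invmx S by rewrite trmx_inv (proj1 pS).
  by rewrite linearB !linearZ /= !trmx_mul !trmxK sV sW -!mulmxA.
(* [e] is the steady-state residual caused by the bias [Da u]; it solves [(I + M L) e = Da u], as
   [attack_lmi_bound] requires. *)
pose e := invmx (1%:M + M *m L) *m (Da *m u).
have := attack_lmi_bound g0 (proj1 pP) GE lmi3 (mulKVmx uJ (Da *m u)); rewrite -/e => lower.
(* At the test vector [Zt e], the bound [Sig <= Q] and the second LMI keep the form of [S] below
   [e^T Zt e], so at least one of the two copies of [e^T Zt e] survives. *)
have upper : dotc e (Zt *m e) <= dotc e (invmx S *m e).
  apply: le_trans (dotc_invmx_ge e (Zt *m e) pS uS).
  have := residual_lmi_bound pP pZ lmi2 e; have := SigQ (C^T *m (Zt *m e)).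
  rewrite dS mulr2n; lra.
rewrite quad_dotc mulmxBl dotcE -!scalemxAl !dotcE -!mulmxA -/e.
rewrite -!dotc_mulmxl -/e; lra.
Qed.
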